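(* Let $A\in\mathbb{R}^{n\times n}$ be symmetric and let $u\in\mathbb{R}^n$ satisfy $u^TAu\neq 0$. Let $C=[\,u\ \ -Au\,]\in\mathbb{R}^{n\times 2}$ and let $\mu$ be the smallest eigenvalue of $C^TC$. Put $\theta=\frac{u^TAu}{u^Tu}$ and $\widetilde\theta=\frac{u^TA^2u}{u^TAu}$. Then: (i) $\mu$ is a simple eigenvalue of $C^TC$ (equivalently, $\sqrt{\mu}$ is a simple singular value of $C$), and its corresponding eigenvector $[\alpha_1,\alpha_2]^T$ is the unique minimizer, as an element of $\mathbb{P}_1(\mathbb{R})$, of $(\alpha_1,\alpha_2)\mapsto \frac{\|\alpha_1 u-\alpha_2 Au\|}{\sqrt{\alpha_1^2+\alpha_2^2}}$. (ii) $\mu=\tfrac12\Big[u^Tu+u^TA^2u-\sqrt{(u^Tu-u^TA^2u)^2+4(u^TAu)^2}\Big]$. (iii) The homogeneous Rayleigh quotient $\alpha=\alpha_1/\alpha_2$ satisfies $$\alpha=\frac{u^TAu}{u^Tu-\mu}=\frac{u^TA^2u-\mu}{u^TAu}=\frac{1}{2\,u^TAu}\Big[u^TA^2u-u^Tu+\sqrt{(u^TA^2u-u^Tu)^2+4(u^TAu)^2}\Big].$$ In terms of the standard and harmonic Rayleigh quotients, $$\alpha=\tfrac12\Big[\widetilde\theta-\theta^{-1}+\sqrt{(\widetilde\theta-\theta^{-1})^2+4}\Big]=\Big(\tfrac12\Big[\theta^{-1}-\widetilde\theta+\sqrt{(\theta^{-1}-\widetilde\theta)^2+4}\Big]\Big)^{-1}.$$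 (iv) $\mu=0$ if and only if $u$ is an eigenvector of $A$; and if $u$ is an eigenvector of $A$, then $\alpha$ is the corresponding eigenvalue. (v) $0\le\mu<\min(u^Tu,\ u^TA^2u)$. (vi) If $u^TAu>0$ then $\theta\le\alpha\le\widetilde\theta$; if $u^TAu<0$ then $\widetilde\theta\le\alpha\le\theta$.
   Context: $\|\cdot\|$ is the Euclidean norm. $\mathbb{P}_1(\mathbb{R})$ is the real projective line, i.e. $\mathbb{R}^2\setminus\{0\}$ modulo multiplication by nonzero scalars. The homogeneous Rayleigh quotient of $A$ at $u$ is $\alpha=\alpha_1/\alpha_2$, where $(\alpha_1,\alpha_2)\in\mathbb{P}_1(\mathbb{R})$ (with $\alpha_2\ne0$) minimizes $\frac{\|\alpha_1u-\alpha_2Au\|}{\sqrt{\alpha_1^2+\alpha_2^2}}$ over $\mathbb{P}_1(\mathbb{R})$; equivalently, $[\alpha_1,\alpha_2]^T$ minimizes $\|C[\alpha_1,\alpha_2]^T\|$ subject to $\alpha_1^2+\alpha_2^2=1$. $\theta$ is the (standard) Rayleigh quotient and $\widetilde\theta$ the harmonic Rayleigh quotient (with target $0$).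
   Formalization: The last display of (iii), in θ and θ̃, is false when u^TAu<0 (n=1, A=(-1), u=1 gives +1 but α=-1); it is stated as printed for u^TAu>0 and with a minus sign before both square roots for u^TAu<0. *)

(* Defs.v *)
From mathcomp Require Import all_boot all_order all_algebra.

Set Implicit Arguments.
Unset Strict Implicit.
Unset Printing Implicit Defensive.

Import Order.TTheory GRing.Theory Num.Theory.
Local Open Scope ring_scope.

Definition dot (R : rcfType) (n : nat) (x y : 'cV[R]_n) : R := (x^T *m y) 0 0.

Definition enorm (R : rcfType) (n : nat) (x : 'cV[R]_n) : R :=
  Num.sqrt (\sum_(i < n) x i 0 ^+ 2).

(* MathComp's [eigenspace] consists of row vectors [v] with [v *m M = a *: v];
   eigenvectors here are column vectors.  The eigenvalues are the same on
   either side, so [eigenvalue] is used unchanged. *)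
Definition is_eigenvector (R : rcfType) (n : nat) (M : 'M[R]_n) (a : R)
    (v : 'cV[R]_n) : Prop :=
  v != 0 /\ M *m v = a *: v.

Definition smallest_eigenvalue (R : rcfType) (n : nat) (M : 'M[R]_n) (mu : R) :
    Prop :=
  eigenvalue M mu /\ (forall nu : R, eigenvalue M nu -> mu <= nu).

(* Algebraic multiplicity one. *)
Definition simple_eigenvalue (R : rcfType) (n : nat) (M : 'M[R]_n) (mu : R) :
    Prop :=
  mup mu (char_poly M) = 1%N.

(* [s] lists, with multiplicity, the nonnegative square roots of the
   eigenvalues of [C^T *m C]: there are as many as columns of [C], zeros
   being included also when [C] has fewer rows than columns. *)
Definition singular_values (R : rcfType) (m p : nat) (C : 'M[R]_(m, p))
    (s : seq R) : Prop :=
  {in s, forall x, 0 <= x} /\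
  char_poly (C^T *m C) = \prod_(x <- s) ('X - (x ^+ 2)%:P).

Definition simple_singular_value (R : rcfType) (m p : nat) (C : 'M[R]_(m, p))
    (sigma : R) : Prop :=
  exists2 s : seq R, singular_values C s & count_mem sigma s = 1%N.

Definition Cmx (R : rcfType) (n : nat) (A : 'M[R]_n) (u : 'cV[R]_n) :
    'M[R]_(n, 2) :=
  row_mx u (- (A *m u)).

Definition rayleigh (R : rcfType) (n : nat) (A : 'M[R]_n) (u : 'cV[R]_n) : R :=
  dot u (A *m u) / dot u u.

(* Harmonic Rayleigh quotient with target 0. *)
Definition harmonic_rayleigh (R : rcfType) (n : nat) (A : 'M[R]_n)
    (u : 'cV[R]_n) : R :=
  dot u (A *m A *m u) / dot u (A *m u).

(* A point of the real projective line is given by homogeneous coordinates,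
   a nonzero vector of 'cV_2; [same_point] is equality of points. *)
Definition same_point (R : rcfType) (a b : 'cV[R]_2) : Prop :=
  exists2 t : R, t != 0 & b = t *: a.

Definition homogeneous_residual (R : rcfType) (n : nat) (A : 'M[R]_n)
    (u : 'cV[R]_n) (a : 'cV[R]_2) : R :=
  enorm (a 0 0 *: u - a 1 0 *: (A *m u)) /
  Num.sqrt (a 0 0 ^+ 2 + a 1 0 ^+ 2).

Definition residual_minimizer (R : rcfType) (n : nat) (A : 'M[R]_n)
    (u : 'cV[R]_n) (a : 'cV[R]_2) : Prop :=
  a != 0 /\
  (forall b : 'cV[R]_2, b != 0 ->
     homogeneous_residual A u a <= homogeneous_residual A u b).

Definition homogeneous_rayleigh (R : rcfType) (n : nat) (A : 'M[R]_n)
    (u : 'cV[R]_n) (alpha : R) : Prop :=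
  exists a : 'cV[R]_2,
    [/\ residual_minimizer A u a, a 1 0 != 0 & alpha = a 0 0 / a 1 0].

(* Main.v *)
Require Import Defs.
From mathcomp Require Import all_boot all_order all_algebra ring lra.

Set Implicit Arguments.
Unset Strict Implicit.
Unset Printing Implicit Defensive.

Import Order.TTheory GRing.Theory Num.Theory.
Local Open Scope ring_scope.

(* The matrix C^T C is [[p, -r], [-r, q]] with p = u^T u, r = u^T A u and
   q = u^T A^2 u = |Au|^2, so its characteristic polynomial factors as
   (X - mu) (X - nu) with nu = p + q - mu.  Since r != 0 the discriminant
   (p - q)^2 + 4 r^2 = (nu - mu)^2 is positive, and (p - mu) (q - mu) = r^2 > 0
   forces mu < p, q.  Completing the square gives
     |a u - b Au|^2 - mu (a^2 + b^2) = ((p - mu) a - r b)^2 / (p - mu),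
   so the minimizers are the multiples of (r, p - mu), and all the formulas
   for alpha = r / (p - mu) follow.  Finally mu nu = p q - r^2 vanishes exactly
   in the equality case of Cauchy-Schwarz for u and Au. *)

(** * Inner product and Cauchy-Schwarz *)

Section Dot.
Context (R : rcfType) (n : nat).
Implicit Types (x y z : 'cV[R]_n) (a b : R).

Lemma dotE x y : dot x y = \sum_i x i 0 * y i 0.
Proof. by rewrite /dot mxE; apply: eq_bigr => i _; rewrite mxE. Qed.

Lemma dotC x y : dot x y = dot y x.
Proof. by rewrite !dotE; apply: eq_bigr => i _; rewrite mulrC. Qed.

Lemma dotZr a x y : dot x (a *: y) = a * dot x y.
Proof. by rewrite /dot -scalemxAr mxE. Qed.

Lemma dotBr x y z : dot x (y - z) = dot x y - dot x z.
Proof. by rewrite /dot mulmxBr !mxE. Qed.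

Lemma dotZBl a b x y z :
  dot (a *: x - b *: y) z = a * dot x z - b * dot y z.
Proof. by rewrite dotC dotBr !dotZr ![dot z _]dotC. Qed.

Lemma dot_ge0 x : 0 <= dot x x.
Proof. by rewrite dotE sumr_ge0 // => i _; rewrite -expr2 sqr_ge0. Qed.

Lemma dot_eq0 x : dot x x = 0 -> x = 0.
Proof.
rewrite dotE => x0; apply/colP => i; rewrite !mxE; apply/eqP.
(* Doubling the goal [x i 0 == 0] turns it into the vanishing of a summand [x i 0 * x i 0]. *)
rewrite -[_ == _]orbb -mulf_eq0.
by rewrite (psumr_eq0P _ x0) // => j _; rewrite -expr2 sqr_ge0.
Qed.

Lemma dot0r x : dot x 0 = 0.
Proof. by rewrite /dot mulmx0 mxE. Qed.

Lemma dot_sqr_comb a b x y :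
  dot (a *: x - b *: y) (a *: x - b *: y) =
  a ^+ 2 * dot x x - 2 * (a * b) * dot x y + b ^+ 2 * dot y y.
Proof. by rewrite dotZBl !dotBr !dotZr [dot y x]dotC; ring. Qed.

Lemma dot_gt0 x y : dot x y != 0 -> 0 < dot x x.
Proof.
rewrite lt0r dot_ge0 andbT; apply: contra_neq => /dot_eq0 ->.
by rewrite dotC dot0r.
Qed.

(** The squared norm of [dot x y *: x - dot x x *: y] is [dot x x] times the difference of the two
    sides. *)
Lemma cauchy_schwarz x y : 0 < dot x x -> dot x y ^+ 2 <= dot x x * dot y y.
Proof.
move=> x0; have := dot_ge0 (dot x y *: x - dot x x *: y).
rewrite dot_sqr_comb.
rewrite (_ : _ + _ = dot x x * (dot x x * dot y y - dot x y ^+ 2)); last ring.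
by rewrite pmulr_rge0 // subr_ge0.
Qed.

(** In the equality case the vector from the inequality's proof has norm zero. *)
Lemma cauchy_schwarz_eq x y :
  dot x y ^+ 2 = dot x x * dot y y -> dot x y *: x = dot x x *: y.
Proof.
move=> E; apply/eqP; rewrite -subr_eq0; apply/eqP; apply: dot_eq0.
rewrite dot_sqr_comb (_ : _ + _ = dot x x * (dot x x * dot y y - dot x y ^+ 2)).
  by rewrite E subrr mulr0.
by ring.
Qed.

Lemma enormE x : enorm x = Num.sqrt (dot x x).
Proof.
by rewrite /enorm dotE; congr Num.sqrt; apply: eq_bigr => i _; rewrite expr2.
Qed.

End Dot.

(** * Two-by-two matrices and the Gram matrix of [Cmx A u] *)

Lemma char_poly_mx2 (R : comNzRingType) (M : 'M[R]_2) :
  char_poly M =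
  ('X - (M 0 0)%:P) * ('X - (M 1 1)%:P) - (M 0 1 * M 1 0)%:P.
Proof.
rewrite /char_poly (expand_det_row _ 0) big_ord_recl big_ord1.
rewrite /cofactor !det_mx11 !mxE /=.
have E1 : lift 0 0 = 1 :> 'I_2 by apply: val_inj.
have E0 : lift 1 0 = 0 :> 'I_2 by apply: val_inj.
by rewrite ?E1 ?E0 /= !polyCM; ring.
Qed.

Lemma mulmx2 (R : pzSemiRingType) (m : nat) (M : 'M[R]_(m, 2)) (v : 'cV[R]_2) i :
  (M *m v) i 0 = M i 0 * v 0 0 + M i 1 * v 1 0.
Proof.
by rewrite mxE big_ord_recl big_ord1 (_ : lift 0 0 = 1) //; apply: val_inj.
Qed.

Lemma col2P (T : Type) (v w : 'cV[T]_2) :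
  v 0 0 = w 0 0 -> v 1 0 = w 1 0 -> v = w.
Proof.
move=> e0 e1; apply/colP => -[[|[|//]] i2].
- by rewrite (_ : Ordinal i2 = 0) //; apply: val_inj.
- by rewrite (_ : Ordinal i2 = 1) //; apply: val_inj.
Qed.

Lemma sqnorm2_gt0 (R : realDomainType) (b : 'cV[R]_2) :
  b != 0 -> 0 < b 0 0 ^+ 2 + b 1 0 ^+ 2.
Proof.
rewrite lt0r addr_ge0 ?sqr_ge0 // andbT; apply: contra_neq => /eqP.
rewrite paddr_eq0 ?sqr_ge0 // !sqrf_eq0 => /andP[/eqP b0 /eqP b1].
by apply: col2P; rewrite mxE.
Qed.

Lemma Cmx_gramE (R : rcfType) (n : nat) (A : 'M[R]_n) (u : 'cV[R]_n) :
  let M := (Cmx A u)^T *m Cmx A u in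
  [/\ M 0 0 = dot u u, M 0 1 = - dot u (A *m u), M 1 0 = - dot u (A *m u) &
      M 1 1 = dot (A *m u) (A *m u)].
Proof.
have o0 : 0 = lshift 1 (0 : 'I_1) :> 'I_2 by apply: val_inj.
have o1 : 1 = rshift 1 (0 : 'I_1) :> 'I_2 by apply: val_inj.
have e0 i : Cmx A u i 0 = u i 0 by rewrite o0; exact: row_mxEl.
have e1 i : Cmx A u i 1 = - (A *m u) i 0 
  by rewrite o1; apply: etrans (row_mxEr _ _ _ _) _; rewrite mxE.
rewrite !dotE -!sumrN /=; split; rewrite mxE; apply: eq_bigr => i _;
  by rewrite mxE ?e0 ?e1; ring.
Qed.

(** The symmetry of A enters only through this identity: it makes q both a Gram entry and the second
    factor in Cauchy-Schwarz for u and Au. *)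
Lemma sym_dot_sqr (R : rcfType) (n : nat) (A : 'M[R]_n) (u : 'cV[R]_n) :
  A^T = A -> dot u (A *m A *m u) = dot (A *m u) (A *m u).
Proof. by move=> sA; rewrite /dot trmx_mul sA !mulmxA. Qed.

(** * Scalar facts about the roots of (p - x) (q - x) = r^2 *)

Lemma sqrtr_divr_sqrD4 (R : rcfType) (x r : R) : r != 0 ->
  Num.sqrt ((x / r) ^+ 2 + 4) = Num.sqrt (x ^+ 2 + 4 * r ^+ 2) / `|r|.
Proof.
move=> r0; rewrite (_ : _ + 4 = (x ^+ 2 + 4 * r ^+ 2) / r ^+ 2); last by field.
have x4_ge0 : 0 <= x ^+ 2 + 4 * r ^+ 2.
  by have := sqr_ge0 x; have := sqr_ge0 r; lra.
by rewrite sqrtrM // sqrtrV ?sqr_ge0 // sqrtr_sqr.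
Qed.

(** Scalar form of (iii), with x, t, s standing for mu, theta and the harmonic quotient. Dividing
    the discriminant by r^2 brings out [|r|], hence the two cases: alpha has the sign of r, while
    the expression with +sqrt is always positive. Once the root is replaced by p + q - 2x, all the
    formulas are rational. *)
Lemma quad_root_formulas (R : rcfType) (p q r x : R) :
  r != 0 -> x < p -> (p - x) * (q - x) = r ^+ 2 ->
  Num.sqrt ((p - q) ^+ 2 + 4 * r ^+ 2) = p + q - x - x ->
  let t := r / p in let s := q / r in
  r / (p - x) = (q - x) / r /\
  r / (p - x) =
    (2 * r)^-1 * (q - p + Num.sqrt ((q - p) ^+ 2 + 4 * r ^+ 2)) /\
  (0 < r ->
     r / (p - x) = 2^-1 * (s - t^-1 + Num.sqrt ((s - t^-1) ^+ 2 + 4)) /\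
     r / (p - x) = (2^-1 * (t^-1 - s + Num.sqrt ((t^-1 - s) ^+ 2 + 4)))^-1) /\
  (r < 0 ->
     r / (p - x) = 2^-1 * (s - t^-1 - Num.sqrt ((s - t^-1) ^+ 2 + 4)) /\
     r / (p - x) = (2^-1 * (t^-1 - s - Num.sqrt ((t^-1 - s) ^+ 2 + 4)))^-1).
Proof.
move=> r0 x_lt e disc t s.
have d0 : p - x != 0 by rewrite subr_eq0 gt_eqF.
have ratio : r / (p - x) = (q - x) / r.
  apply: (mulIf r0); rewrite divfK //; apply: (mulIf d0).
  by rewrite [RHS]mulrC e mulrAC divfK // expr2.
have ratioV : r / (p - x) = ((p - x) / r)^-1 by rewrite invf_div.
have disc' : Num.sqrt ((q - p) ^+ 2 + 4 * r ^+ 2) = p + q - x - x.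
  by rewrite -sqrrN opprB.
have ts : t^-1 - s = (p - q) / r by rewrite /t /s invf_div mulrBl.
have st : s - t^-1 = (q - p) / r by rewrite /t /s invf_div mulrBl.
rewrite ts st !sqrtr_divr_sqrD4 // disc disc'.
split=> //; split; first by rewrite ratio; field.
split=> r_sg; rewrite ?(gtr0_norm r_sg) ?(ltr0_norm r_sg).
  by split; [rewrite ratio|rewrite ratioV; congr (_^-1)]; field.
by split; [rewrite ratio|rewrite ratioV; congr (_^-1)]; field.
Qed.

(** The middle term is r / p with a smaller denominator, and also equals (q - x) / r, which is q / r
    with a smaller numerator; the sign of r orients both comparisons. *)
Lemma quad_root_between (R : realFieldType) (p q r x : R) :
  0 < p -> 0 <= x -> x < p -> (p - x) * (q - x) = r ^+ 2 ->
  (0 < r -> r / p <= r / (p - x) /\ r / (p - x) <= q / r) /\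
  (r < 0 -> q / r <= r / (p - x) /\ r / (p - x) <= r / p).
Proof.
move=> p0 x0 x_lt e; have d0 : 0 < p - x by rewrite subr_gt0.
have le_inv : p^-1 <= (p - x)^-1 by rewrite lef_pV2 ?posrE // lerBlDr lerDl.
have ratio : r != 0 -> r / (p - x) = (q - x) / r.
  move=> r0; apply: (mulIf r0); rewrite divfK //; apply: (mulIf (lt0r_neq0 d0)).
  by rewrite [RHS]mulrC e mulrAC divfK ?expr2 // lt0r_neq0.
split=> r_sg; split.
- by rewrite ler_pM2l.
- by rewrite ratio ?gt_eqF // ler_pM2r ?invr_gt0 // lerBlDr lerDl.
- by rewrite ratio ?lt_eqF // ler_nM2r ?invr_lt0 // lerBlDr lerDl.
- by rewrite ler_nM2l.
Qed.


(** Equal roots would give p - x = -(q - x), hence r^2 = -(q - x)^2 <= 0. *)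
Lemma quad_roots_lt (R : realFieldType) (p q r x : R) :
  r != 0 -> (p - x) * (q - x) = r ^+ 2 -> x <= p + q - x -> x < p + q - x.
Proof.
move=> r_neq0 e le_x; case: ltrP => // ge_x.
have : 0 < r ^+ 2 by rewrite lt0r sqrf_eq0 r_neq0 sqr_ge0.
rewrite -e (_ : p - x = - (q - x)); last by lra.
by rewrite mulNr -expr2 oppr_gt0 ltNge sqr_ge0.
Qed.

(** The factors p - x and q - x have positive product and positive sum, so both are positive. Then x
    (p + q - x) = p q - (p - x) (q - x) >= 0 gives the sign of x. *)
Lemma quad_root_bounds (R : realFieldType) (p q x : R) :
  0 < p -> 0 < (p - x) * (q - x) -> (p - x) * (q - x) <= p * q -> x < p + q - x ->
  [/\ x < p, x < q & 0 <= x].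
Proof.
move=> p_gt0 gt0 le_pq lt_x; have [p_le|p_gt] := lerP p x.
  have [q_ge|q_lt] := lerP x q; last by lra.
  suff : (p - x) * (q - x) <= 0 by rewrite leNgt gt0.
  by apply: mulr_le0_ge0; lra.
have q_gt : x < q.
  by rewrite -subr_gt0; move: gt0; rewrite pmulr_rgt0 // subr_gt0.
split=> //; have y_gt0 : 0 < p + q - x by lra.
rewrite -(pmulr_lge0 _ y_gt0).
rewrite (_ : x * _ = p * q - (p - x) * (q - x)) ?subr_ge0 //.
by ring.
Qed.

(** * The smallest Gram eigenvalue and the residual minimizers *)

Section SmallestGramEigenvalue.
Context (R : rcfType) (n : nat) (A : 'M[R]_n) (u : 'cV[R]_n) (mu : R).
Context (symA : A^T = A).
Context (uAu_neq0 : dot u (A *m u) != 0).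
Context (mu_min : smallest_eigenvalue ((Cmx A u)^T *m Cmx A u) mu).

Local Notation M := ((Cmx A u)^T *m Cmx A u).
Local Notation p := (dot u u).
Local Notation r := (dot u (A *m u)).
Local Notation q := (dot u (A *m A *m u)).
Local Notation nu := (p + q - mu).

Let sqr_r_gt0 : 0 < r ^+ 2.
Proof. by rewrite lt0r sqrf_eq0 uAu_neq0 sqr_ge0. Qed.

Let p_gt0 : 0 < p.
Proof. exact: dot_gt0 uAu_neq0. Qed.

Lemma gram_char_eq : (p - mu) * (q - mu) = r ^+ 2.
Proof.
have [+ _] := mu_min; rewrite eigenvalue_root_char char_poly_mx2.
have [-> -> -> ->] := Cmx_gramE A u.
rewrite -sym_dot_sqr // rootE !hornerE => /eqP e; apply/eqP.
by rewrite -subr_eq0 -e; apply/eqP; ring.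
Qed.

Lemma gram_char_poly : char_poly M = ('X - mu%:P) * ('X - nu%:P).
Proof.
rewrite char_poly_mx2; have [-> -> -> ->] := Cmx_gramE A u.
rewrite -sym_dot_sqr // mulrNN -expr2 -gram_char_eq.
by rewrite !(polyCM, polyCB, polyCD); ring.
Qed.

(** The minimality of mu is used only here, against the other root nu. *)
Lemma gram_eigenvalue_lt : mu < nu.
Proof.
apply: quad_roots_lt uAu_neq0 gram_char_eq _; have [_] := mu_min.
by apply; rewrite eigenvalue_root_char gram_char_poly rootM !root_XsubC eqxx orbT.
Qed.

Lemma gram_eigenvalue_bounds : [/\ mu < p, mu < q & 0 <= mu].
Proof.
apply: quad_root_bounds p_gt0 _ _ gram_eigenvalue_lt; rewrite gram_char_eq //.
by rewrite sym_dot_sqr // cauchy_schwarz.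
Qed.

Lemma gram_discriminant :
  Num.sqrt ((p - q) ^+ 2 + 4 * r ^+ 2) = nu - mu.
Proof.
rewrite -gram_char_eq (_ : _ + _ = (nu - mu) ^+ 2); last by ring.
by rewrite sqrtr_sqr ger0_norm // subr_ge0 ltW // gram_eigenvalue_lt.
Qed.

Lemma gram_simple_eigenvalue : simple_eigenvalue M mu.
Proof.
have lt_mu := gram_eigenvalue_lt.
rewrite /simple_eigenvalue gram_char_poly -['X - _]expr1 mupMl ?mup_XsubCX ?eqxx //.
by rewrite root_XsubC lt_eqF.
Qed.

Lemma gram_simple_singular_value :
  simple_singular_value (Cmx A u) (Num.sqrt mu).
Proof.
have lt_mu := gram_eigenvalue_lt; have [_ _ mu_ge0] := gram_eigenvalue_bounds.
exists [:: Num.sqrt mu; Num.sqrt nu].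
  split=> [x|]; first by rewrite !inE => /orP[] /eqP ->; exact: sqrtr_ge0.
  by rewrite gram_char_poly !big_cons big_nil mulr1 !sqr_sqrtr //; lra.
rewrite /= eqxx addn0 gt_eqF // ltr_sqrt //; lra.
Qed.

Lemma residual_sqr (b : 'cV[R]_2) :
  dot (b 0 0 *: u - b 1 0 *: (A *m u)) (b 0 0 *: u - b 1 0 *: (A *m u)) =
  mu * (b 0 0 ^+ 2 + b 1 0 ^+ 2)
  + ((p - mu) * b 0 0 - r * b 1 0) ^+ 2 / (p - mu).
Proof.
have [p_gt _ _] := gram_eigenvalue_bounds.
rewrite dot_sqr_comb -sym_dot_sqr //.
have d0 : p - mu != 0 by rewrite subr_eq0 gt_eqF.
(* Eliminating q by the characteristic equation leaves a rational identity in p, r, mu and the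
   coordinates of b. *)
rewrite (_ : q = mu + r ^+ 2 / (p - mu)); first by field.
by rewrite -gram_char_eq; field.
Qed.

(** Under the root, mu is the minimum and the other term is a nonnegative excess. *)
Lemma homogeneous_residualE (b : 'cV[R]_2) : b != 0 ->
  homogeneous_residual A u b =
  Num.sqrt (mu + ((p - mu) * b 0 0 - r * b 1 0) ^+ 2
                 / ((p - mu) * (b 0 0 ^+ 2 + b 1 0 ^+ 2))).
Proof.
have [p_gt _ _] := gram_eigenvalue_bounds.
have d0 : p - mu != 0 by rewrite subr_eq0 gt_eqF.
move=> /sqnorm2_gt0 b_gt0; have b_neq0 := lt0r_neq0 b_gt0.
rewrite /homogeneous_residual enormE -sqrtrV ?ltW // mulrC -sqrtrM ?invr_ge0 ?ltW //.
by rewrite residual_sqr; congr Num.sqrt; field; rewrite b_neq0.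
Qed.

(** This point has zero excess; it attains the minimum and serves as witness that alpha exists. *)
Lemma optimal_point :
  exists b : 'cV[R]_2, [/\ b != 0, b 0 0 = r & b 1 0 = p - mu].
Proof.
exists (\col_i (if i == 0 then r else p - mu)); split; rewrite ?mxE //.
by apply: contra_neq uAu_neq0 => /colP/(_ 0); rewrite !mxE.
Qed.

Lemma residual_minimizerP (a : 'cV[R]_2) : a != 0 ->
  residual_minimizer A u a <-> (p - mu) * a 0 0 = r * a 1 0.
Proof.
have [p_gt _ mu_ge0] := gram_eigenvalue_bounds => a0.
have pos (b : 'cV[R]_2) : b != 0 -> 0 < (p - mu) * (b 0 0 ^+ 2 + b 1 0 ^+ 2).
  by move=> b0; rewrite mulr_gt0 ?sqnorm2_gt0 // subr_gt0.
have excess_ge0 (b : 'cV[R]_2) : b != 0 ->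
    0 <= ((p - mu) * b 0 0 - r * b 1 0) ^+ 2
         / ((p - mu) * (b 0 0 ^+ 2 + b 1 0 ^+ 2)).
  by move=> b0; rewrite divr_ge0 ?sqr_ge0 // ltW ?pos.
split=> [[_ a_min]|e]; last first.
  split=> // b b0; rewrite !homogeneous_residualE // e subrr expr0n mul0r addr0.
  by rewrite ler_wsqrtr // lerDl excess_ge0.
(* Comparison with the optimal point forces the excess of [a] to be at most 0, hence 0. *)
have [b [b0 b00 b10]] := optimal_point.
have := a_min b b0; rewrite !homogeneous_residualE // b00 b10.
rewrite [r * (p - mu)]mulrC subrr expr0n mul0r addr0 ler_sqrt //.
rewrite gerDl => le0; have /eqP := le_anti (introT andP (conj le0 (excess_ge0 a a0))).
by rewrite mulf_eq0 invr_eq0 (gt_eqF (pos a a0)) orbF sqrf_eq0 subr_eq0 => /eqP.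
Qed.

Lemma residual_minimizer_ratio (a : 'cV[R]_2) : residual_minimizer A u a ->
  a 1 0 != 0 /\ a 0 0 = r / (p - mu) * a 1 0.
Proof.
have [p_gt _ _] := gram_eigenvalue_bounds => a_min; have [a0 _] := a_min.
have d0 : p - mu != 0 by rewrite subr_eq0 gt_eqF.
have a0E : a 0 0 = r / (p - mu) * a 1 0.
  have /(residual_minimizerP a0) e := a_min.
  by rewrite mulrAC -e mulrAC mulfV ?mul1r.
(* If the second coordinate vanished, so would the first, and [a] would be no projective point. *)
split=> //; apply: contra_neq a0 => a1.
by apply: col2P; rewrite ?a0E a1 ?mulr0 mxE.
Qed.

Lemma homogeneous_rayleighP (alpha : R) :
  homogeneous_rayleigh A u alpha <-> alpha = r / (p - mu).
Proof.
have [p_gt _ _] := gram_eigenvalue_bounds.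
have d0 : p - mu != 0 by rewrite subr_eq0 gt_eqF.
split=> [[a [/residual_minimizer_ratio[a1 ->] _ ->]]|->]; first by rewrite mulfK.
have [b [b0 b00 b10]] := optimal_point.
exists b; split; rewrite ?b00 ?b10 //.
by apply/(residual_minimizerP b0); rewrite b00 b10 mulrC.
Qed.

Lemma gram_eigenvector_minimizer (a : 'cV[R]_2) :
  is_eigenvector M mu a -> residual_minimizer A u a.
Proof.
(* The first row of the eigenvector equation is already the linear equation of the minimizers. *)
move=> [a0 /colP/(_ 0)]; rewrite mulmx2 [RHS]mxE.
have [-> -> _ _] := Cmx_gramE A u.
by move=> e; apply/(residual_minimizerP a0); rewrite mulrBl -e; ring.
Qed.

Lemma residual_minimizer_unique (a b : 'cV[R]_2) :
  residual_minimizer A u a -> residual_minimizer A u b -> same_point a b.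
Proof.
move=> /residual_minimizer_ratio[a1 aE] /residual_minimizer_ratio[b1 bE].
exists (b 1 0 / a 1 0); first by rewrite mulf_neq0 ?invr_neq0.
(* The common ratio is abstracted, so that [a 1 0] is the only denominator left for [field]. *)
move: (r / _) aE bE => k aE bE.
by apply: col2P; rewrite [RHS]mxE ?aE ?bE; field.
Qed.

Lemma gram_eigenvalue_eq0 : mu = 0 <-> exists l : R, is_eigenvector A l u.
Proof.
have [_ _ mu_ge0] := gram_eigenvalue_bounds; have lt_mu := gram_eigenvalue_lt.
have e := gram_char_eq.
split=> [mu0|[l [_ Au]]].
  (* With mu = 0 the characteristic equation is p q = r^2, so Cauchy-Schwarz is an equality and r u
     = p Au. *)
  exists (r / p); split; first by apply: contraNneq uAu_neq0 => ->; rewrite mulmx0 dot0r.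
  rewrite mu0 !subr0 sym_dot_sqr // in e.
  rewrite mulrC -scalerA (cauchy_schwarz_eq (esym e)) scalerA mulVf ?scale1r //.
  exact: lt0r_neq0.
have rE : r = l * p by rewrite Au dotZr.
have qE : q = l ^+ 2 * p by rewrite -mulmxA Au -scalemxAr Au scalerA dotZr expr2.
(* For Au = l u the product of the roots, p q - r^2, vanishes; nu > mu >= 0 leaves only mu = 0. *)
have : mu * nu = 0.
  rewrite (_ : _ * _ = p * q - (p - mu) * (q - mu)); last by ring.
  by rewrite e rE qE; ring.
by move=> /eqP; rewrite mulf_eq0 [nu == 0]gt_eqF ?orbF => [/eqP|]; lra.
Qed.

End SmallestGramEigenvalue.

Theorem proposition1 (R : rcfType) (n : nat) (A : 'M[R]_n) (u : 'cV[R]_n)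
    (mu : R) (symA : A^T = A) (uAu_neq0 : dot u (A *m u) != 0)
    (mu_min : smallest_eigenvalue ((Cmx A u)^T *m Cmx A u) mu) :
  (* (i) *)
  (simple_eigenvalue ((Cmx A u)^T *m Cmx A u) mu /\
   simple_singular_value (Cmx A u) (Num.sqrt mu) /\
   (forall a : 'cV[R]_2, is_eigenvector ((Cmx A u)^T *m Cmx A u) mu a ->
      residual_minimizer A u a /\
      (forall b : 'cV[R]_2, residual_minimizer A u b -> same_point a b)))
  /\
  (* (ii) *)
  (mu = 2^-1 * (dot u u + dot u (A *m A *m u)
          - Num.sqrt ((dot u u - dot u (A *m A *m u)) ^+ 2
                      + 4 * dot u (A *m u) ^+ 2)))
  /\
  (* the homogeneous Rayleigh quotient is well defined *)
  (exists! alpha : R, homogeneous_rayleigh A u alpha)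
  /\
  (* (iii) *)
  (forall alpha : R, homogeneous_rayleigh A u alpha ->
     alpha = dot u (A *m u) / (dot u u - mu) /\
     alpha = (dot u (A *m A *m u) - mu) / dot u (A *m u) /\
     alpha = (2 * dot u (A *m u))^-1 *
       (dot u (A *m A *m u) - dot u u
        + Num.sqrt ((dot u (A *m A *m u) - dot u u) ^+ 2
                    + 4 * dot u (A *m u) ^+ 2)) /\
     (* the sign of the root is that of u^T A u *)
     (0 < dot u (A *m u) ->
        alpha = 2^-1 * (harmonic_rayleigh A u - (rayleigh A u)^-1
          + Num.sqrt ((harmonic_rayleigh A u - (rayleigh A u)^-1) ^+ 2 + 4)) /\
        alpha = (2^-1 * ((rayleigh A u)^-1 - harmonic_rayleigh A u
          + Num.sqrt (((rayleigh A u)^-1 - harmonic_rayleigh A u) ^+ 2 + 4)))^-1)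
     /\
     (dot u (A *m u) < 0 ->
        alpha = 2^-1 * (harmonic_rayleigh A u - (rayleigh A u)^-1
          - Num.sqrt ((harmonic_rayleigh A u - (rayleigh A u)^-1) ^+ 2 + 4)) /\
        alpha = (2^-1 * ((rayleigh A u)^-1 - harmonic_rayleigh A u
          - Num.sqrt (((rayleigh A u)^-1 - harmonic_rayleigh A u) ^+ 2 + 4)))^-1))
  /\
  (* (iv) *)
  ((mu = 0 <-> exists lambda : R, is_eigenvector A lambda u) /\
   (forall alpha lambda : R, homogeneous_rayleigh A u alpha ->
      is_eigenvector A lambda u -> alpha = lambda))
  /\
  (* (v) *)
  (0 <= mu /\ mu < Num.min (dot u u) (dot u (A *m A *m u)))
  /\
  (* (vi) *)
  (forall alpha : R, homogeneous_rayleigh A u alpha ->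
     (0 < dot u (A *m u) ->
        rayleigh A u <= alpha /\ alpha <= harmonic_rayleigh A u) /\
     (dot u (A *m u) < 0 ->
        harmonic_rayleigh A u <= alpha /\ alpha <= rayleigh A u)).
Proof.
have r0 := uAu_neq0; have lt_mu := gram_eigenvalue_lt symA r0 mu_min.
have [p_gt q_gt mu_ge0] := gram_eigenvalue_bounds symA r0 mu_min.
have disc := gram_discriminant symA r0 mu_min.
have e := gram_char_eq symA mu_min.
have alphaP := homogeneous_rayleighP symA r0 mu_min.
have p_gt0 : 0 < dot u u := dot_gt0 r0.
have iv := gram_eigenvalue_eq0 symA r0 mu_min.
split.
  split; first exact: gram_simple_eigenvalue.
  split; first exact: gram_simple_singular_value.
  move=> a /(gram_eigenvector_minimizer symA r0 mu_min) a_min; split=> // b.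
  exact: residual_minimizer_unique symA r0 mu_min _ _ a_min.
split; first by rewrite disc; field.
split.
  exists (dot u (A *m u) / (dot u u - mu)); split; first exact/alphaP.
  by move=> a /alphaP.
split.
  move=> _ /alphaP ->; rewrite /harmonic_rayleigh /rayleigh.
  split=> //; exact: quad_root_formulas r0 p_gt e disc.
split.
  split=> // _ l /alphaP -> u_eig.
  (* With mu = 0, alpha becomes r / p, which is l because r = l p. *)
  have -> : mu = 0 by apply/iv; exists l.
  by have [_ ->] := u_eig; rewrite dotZr subr0 mulfK // gt_eqF.
split; first by rewrite lt_min p_gt q_gt.
move=> _ /alphaP ->; rewrite /harmonic_rayleigh /rayleigh.
exact: quad_root_between.
Qed.
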